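(* Let $p$ be a positive integer and let $G$ be a finite simple graph which is both $(P_3\cup P_2)$-free and $((K_1\cup K_2)+K_p)$-free, with $\omega(G)\geq\max\{3,3p-1\}$. Let $A=\{v_1,\dots,v_\omega\}$ be a maximum clique of $G$ and let $U_1,\dots,U_\omega$, $V_1$, $V_2$ be defined with respect to $A$ as in the context. Then (i) $\langle V_1\rangle$ is a complete multipartite graph with parts $U_1,\dots,U_\omega$; (ii) $\langle V_2\rangle$ is $P_3$-free; and (iii) $\chi(G)\leq\omega(G)+p-1$.
   Context: All graphs are finite, simple, undirected. $\omega(\cdot)$ is the clique number, $\chi(\cdot)$ the chromatic number, $\langle S\rangle$ the subgraph induced by $S$. $P_n$ is the path on $n$ vertices, $K_n$ the complete graph; $G_1\cup G_2$ is disjoint union and $G_1+G_2$ is the join. A graph is $H$-free if it has no induced subgraph isomorphic to $H$. Partition: let $A=\{v_1,\dots,v_\omega\}$ be a maximum clique, $\omega=\omega(G)$; $L=\{(i,j):1\le i<j\le\omega\}$ ordered lexicographically. For $(i,j)\in L$, $C_{i,j}$ is the set of vertices of $V(G)\setminus A$ adjacent to neither $v_i$ nor $v_j$, minus all $C_{i',j'}$ with $(i',j')$ lexicographically earlier. $I_k$ ($1\le k\le\omega$) is the set of vertices of $V(G)\setminus A$ adjacent to all $v_i$, $i\neq k$. $U_k=\{v_k\}\cup I_k$, $V_1=\bigcup_k U_k$, $V_2=\bigcup_{(i,j)\in L}C_{i,j}$, so $V(G)=V_1\cup V_2$. *)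

(* Defs.v *)
From HB Require Import structures.
From mathcomp Require Import all_boot all_order.

Set Implicit Arguments.
Unset Strict Implicit.
Unset Printing Implicit Defensive.

Record sgraph := SGraph {
  vertex :> finType;
  adj : rel vertex;
  adj_sym : symmetric adj;
  adj_irrefl : irreflexive adj }.

Notation "x -- y" := (adj x y) (at level 30).

Lemma induced_sym (G : sgraph) (S : {set G}) :
  symmetric (fun x y : {x : G | x \in S} => val x -- val y).
Proof. by move=> x y; apply: adj_sym. Qed.

Lemma induced_irrefl (G : sgraph) (S : {set G}) :
  irreflexive (fun x y : {x : G | x \in S} => val x -- val y).
Proof. by move=> x; apply: adj_irrefl. Qed.

Definition induced (G : sgraph) (S : {set G}) : sgraph :=
  SGraph (@induced_sym G S) (@induced_irrefl G S).

Definition path_rel (n : nat) : rel 'I_n :=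
  fun i j => (i.+1 == j :> nat) || (j.+1 == i :> nat).

Lemma path_rel_sym n : symmetric (@path_rel n).
Proof. by move=> i j; rewrite /path_rel orbC. Qed.

Lemma path_rel_irrefl n : irreflexive (@path_rel n).
Proof. by move=> i; rewrite /path_rel orbb gtn_eqF. Qed.

Definition path_graph (n : nat) : sgraph :=
  SGraph (@path_rel_sym n) (@path_rel_irrefl n).

Definition complete_rel (n : nat) : rel 'I_n := fun i j => i != j.

Lemma complete_rel_sym n : symmetric (@complete_rel n).
Proof. by move=> i j; rewrite /complete_rel eq_sym. Qed.

Lemma complete_rel_irrefl n : irreflexive (@complete_rel n).
Proof. by move=> i; rewrite /complete_rel eqxx. Qed.

Definition complete_graph (n : nat) : sgraph :=
  SGraph (@complete_rel_sym n) (@complete_rel_irrefl n).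

Definition union_rel (G1 G2 : sgraph) : rel (G1 + G2)%type :=
  fun x y => match x, y with
             | inl a, inl b => a -- b
             | inr a, inr b => a -- b
             | _, _ => false
             end.

Lemma union_rel_sym G1 G2 : symmetric (@union_rel G1 G2).
Proof. by case=> a [] b //=; apply: adj_sym. Qed.

Lemma union_rel_irrefl G1 G2 : irreflexive (@union_rel G1 G2).
Proof. by case=> a /=; apply: adj_irrefl. Qed.

Definition graph_union (G1 G2 : sgraph) : sgraph :=
  SGraph (@union_rel_sym G1 G2) (@union_rel_irrefl G1 G2).

Definition join_rel (G1 G2 : sgraph) : rel (G1 + G2)%type :=
  fun x y => match x, y with
             | inl a, inl b => a -- b
             | inr a, inr b => a -- b
             | _, _ => true
             end.

Lemma join_rel_sym G1 G2 : symmetric (@join_rel G1 G2).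
Proof. by case=> a [] b //=; apply: adj_sym. Qed.

Lemma join_rel_irrefl G1 G2 : irreflexive (@join_rel G1 G2).
Proof. by case=> a /=; apply: adj_irrefl. Qed.

Definition graph_join (G1 G2 : sgraph) : sgraph :=
  SGraph (@join_rel_sym G1 G2) (@join_rel_irrefl G1 G2).

Definition isomorphic (G H : sgraph) : Prop :=
  exists f : G -> H, bijective f /\ forall x y, f x -- f y = x -- y.

Definition free (H G : sgraph) : Prop :=
  forall S : {set G}, ~ isomorphic H (induced S).

Definition clique (G : sgraph) (S : {set G}) : bool :=
  [forall x in S, forall y in S, (x != y) ==> x -- y].

Definition omega (G : sgraph) : nat := \max_(S : {set G} | clique S) #|S|.

Definition maximum_clique (G : sgraph) (S : {set G}) : Prop :=
  clique S /\ #|S| = omega G.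

Definition colorable (G : sgraph) (k : nat) : bool :=
  [exists c : {ffun G -> 'I_k}, forall x, forall y, x -- y ==> (c x != c y)].

Lemma colorable_card (G : sgraph) : exists k, colorable G k.
Proof.
exists #|G|; apply/existsP; exists [ffun x => enum_rank x].
apply/forallP=> x; apply/forallP=> y; apply/implyP=> xy.
rewrite !ffunE (inj_eq enum_rank_inj).
by apply: contraTneq xy => ->; rewrite adj_irrefl.
Qed.

Definition chi (G : sgraph) : nat := ex_minn (colorable_card G).

Definition complete_multipartite (G : sgraph) (I : finType)
    (P : I -> {set G}) : Prop :=
  [/\ forall i, P i != set0,
      forall i j, i != j -> [disjoint P i & P j],
      \bigcup_i P i = [set: G]
    & forall i j x y, x \in P i -> y \in P j -> x -- y = (i != j)].

Definition lexlt (n : nat) (q p : 'I_n * 'I_n) : bool :=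
  ((q : 'I_n *l 'I_n) < p)%O.

Definition nonadj_pair (G : sgraph) (n : nat) (v : 'I_n -> G)
    (p : 'I_n * 'I_n) : {set G} :=
  [set x in ~: [set v k | k : 'I_n] | ~~ (x -- v p.1) & ~~ (x -- v p.2)].

(** Subtracting the raw sets [nonadj_pair v q] of the earlier pairs is the same
    as subtracting the earlier sets [Cset v q], which is the usual recursive
    description of these sets: see [Cset_rec]. *)
Definition Cset (G : sgraph) (n : nat) (v : 'I_n -> G) (p : 'I_n * 'I_n) :
    {set G} :=
  nonadj_pair v p :\:
    \bigcup_(q : 'I_n * 'I_n | (q.1 < q.2) && lexlt q p) nonadj_pair v q.

Lemma Cset_rec (G : sgraph) (n : nat) (v : 'I_n -> G) (p : 'I_n * 'I_n) :
  Cset v p = nonadj_pair v p :\: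
    \bigcup_(q : 'I_n * 'I_n | (q.1 < q.2) && lexlt q p) Cset v q.
Proof.
rewrite {1}/Cset; congr (_ :\: _); apply/setP=> x; apply/bigcupP/bigcupP.
- case=> q0 q0P xq0.
  pose P (q : 'I_n *l 'I_n) :=
    [&& q.1 < q.2, lexlt q p & x \in nonadj_pair v q].
  have Pq0 : P q0 by case/andP: q0P => lt0 lx0; apply/and3P.
  case: (@Order.TotalTheory.arg_minP _ _ _ (q0 : 'I_n *l 'I_n) P id Pq0).
  move=> q /and3P[lt_q lx_q xq] min_q; exists q; first exact/andP.
  rewrite /Cset inE xq andbT; apply/bigcupP=> -[r /andP[lt_r lx_r] xr].
  have Pr : P r.
    by apply/and3P; split=> //; apply: (Order.POrderTheory.lt_trans lx_r lx_q).
  by have := min_q r Pr; rewrite Order.TotalTheory.leNgt => /negP; apply.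
- by case=> q qP; rewrite /Cset inE => /andP[_ xq]; exists q.
Qed.

Definition Iset (G : sgraph) (n : nat) (v : 'I_n -> G) (k : 'I_n) : {set G} :=
  [set x in ~: [set v i | i : 'I_n] | [forall i, (i != k) ==> x -- v i]].

Definition Uset (G : sgraph) (n : nat) (v : 'I_n -> G) (k : 'I_n) : {set G} :=
  v k |: Iset v k.

Definition V1 (G : sgraph) (n : nat) (v : 'I_n -> G) : {set G} :=
  \bigcup_(k : 'I_n) Uset v k.

Definition V2 (G : sgraph) (n : nat) (v : 'I_n -> G) : {set G} :=
  \bigcup_(p : 'I_n * 'I_n | p.1 < p.2) Cset v p.

(* Main.v *)
(** A transversal of the parts [U_k] is a clique of size [omega], and a vertex
    outside [V1] with two non-neighbours in it has fewer than [p] neighbours in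
    it, by freeness from [(K_1 u K_2) + K_p]. This applies to the clique of the
    [v_k]; changing the transversal then shows that the vertex has neighbours in
    fewer than [p] parts. Three vertices outside [V1] together miss at least two
    of the [v_k], so an induced [P_3] outside [V1] would give an induced
    [P_3 u P_2]. Hence a vertex outside [V1] forms a clique with its neighbours
    outside [V1], and the colouring of [V1] by its parts extends greedily: at
    each step at most [p - 1] colours are excluded by [V1] and [omega - 1] by
    the rest. *)
Require Import Defs.
From mathcomp Require Import all_boot all_order.
From mathcomp Require Import zify.

Set Implicit Arguments.
Unset Strict Implicit.
Unset Printing Implicit Defensive.

(** * Induced embeddings of the forbidden graphs *)

Definition embedding (H G : sgraph) (f : H -> G) : Prop :=
  injective f /\ forall x y, f x -- f y = x -- y.

(** Turns freeness, stated through vertex subsets, into a tool for explicit maps: the image of [f]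
    is the offending subset, and [f] is bijective onto it by counting. *)
Lemma free_embedding (H G : sgraph) (f : H -> G) :
  free H G -> embedding f -> False.
Proof.
move=> freeH [f_inj f_adj]; apply: (freeH (f @: [set: H])).
have fP x : f x \in f @: [set: H] by apply: imset_f; rewrite inE.
exists (fun x => Sub (f x) (fP x)); split=> [|x y]; last exact: f_adj.
apply: inj_card_bij => [x y /(congr1 val) /f_inj // |].
by rewrite /= card_sig card_imset // cardsT.
Qed.

Lemma isomorphic_embedding (H G : sgraph) (S : {set G}) :
  isomorphic H (induced S) ->
  exists2 f : H -> G, embedding f & forall x, f x \in S.
Proof.
case=> f [/bij_inj f_inj f_adj]; exists (fun x => val (f x)).
  by split=> [x y /val_inj /f_inj // | x y]; exact: f_adj.
by move=> x; exact: (valP (f x)).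
Qed.

Lemma embedding_union (H1 H2 G : sgraph) (f1 : H1 -> G) (f2 : H2 -> G) :
  embedding f1 -> embedding f2 ->
  (forall x y, f1 x != f2 y) -> (forall x y, ~~ (f1 x -- f2 y)) ->
  @embedding (graph_union H1 H2) G
    (fun z => match z with inl x => f1 x | inr y => f2 y end).
Proof.
move=> [inj1 adj1] [inj2 adj2] neq nadj; split.
  move=> [x|x] [y|y] => [/inj1-> // | /eqP | /esym/eqP | /inj2-> //].
    by rewrite (negPf (neq _ _)).
  by rewrite (negPf (neq _ _)).
move=> [x|x] [y|y] /=; rewrite ?adj1 ?adj2 //; first exact: negPf.
by rewrite adj_sym; apply: negPf.
Qed.

Lemma embedding_join (H1 H2 G : sgraph) (f1 : H1 -> G) (f2 : H2 -> G) :
  embedding f1 -> embedding f2 -> (forall x y, f1 x -- f2 y) ->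
  @embedding (graph_join H1 H2) G
    (fun z => match z with inl x => f1 x | inr y => f2 y end).
Proof.
move=> [inj1 adj1] [inj2 adj2] adj12; split.
  move=> [x|x] [y|y] => [/inj1-> // | e | e | /inj2-> //].
    by have := adj12 x y; rewrite e adj_irrefl.
  by have := adj12 y x; rewrite e adj_irrefl.
move=> [x|x] [y|y] /=; rewrite ?adj1 ?adj2 //; first exact: adj12.
by rewrite adj_sym; apply: adj12.
Qed.

Lemma embedding_complete1 (G : sgraph) (x : G) :
  @embedding (complete_graph 1) G (fun=> x).
Proof.
split=> [i j _|i j]; first by rewrite !ord1.
by rewrite !ord1 !adj_irrefl.
Qed.

Lemma edge_neq (G : sgraph) (x y : G) : x -- y -> x != y.
Proof. by apply: contraTneq => ->; rewrite adj_irrefl. Qed.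

Lemma embedding_complete2 (G : sgraph) (x y : G) : x -- y ->
  @embedding (complete_graph 2) G (fun i => if i == ord0 then x else y).
Proof.
move=> xy; have := edge_neq xy => /eqP nxy; split.
  move=> [[|[|//]] ?] [[|[|//]] ?] //= e; apply: val_inj => //=.
  by case: nxy.
move=> [[|[|//]] ?] [[|[|//]] ?] //=; rewrite ?adj_irrefl ?xy //.
by rewrite adj_sym xy.
Qed.

Lemma embedding_path2 (G : sgraph) (x y : G) : x -- y ->
  @embedding (path_graph 2) G (fun i => if i == ord0 then x else y).
Proof.
case/embedding_complete2=> inj E; split=> // i j; rewrite E.
by case: i j => [[|[|//]] ?] [[|[|//]] ?].
Qed.

Lemma embedding_path3 (G : sgraph) (x y z : G) :
  x -- y -> y -- z -> x != z -> ~~ (x -- z) ->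
  @embedding (path_graph 3) G (fun i => nth x [:: x; y; z] i).
Proof.
move=> xy yz xz /negPf nxz.
have yx : y -- x by rewrite adj_sym.
have zy : z -- y by rewrite adj_sym.
have nzx : z -- x = false by rewrite adj_sym.
split.
  move=> i j /eqP; rewrite nth_uniq //=.
    by move/eqP/val_inj.
  by rewrite !inE negb_or xz (edge_neq xy) (edge_neq yz).
by move=> [[|[|[|//]]] ?] [[|[|[|//]]] ?] //=; rewrite adj_irrefl.
Qed.

Lemma embedding_clique (G : sgraph) (T : {set G}) (n : nat)
    (leT : n <= #|T|) :
  clique T ->
  @embedding (complete_graph n) G (fun i => enum_val (widen_ord leT i)).
Proof.
move=> /forall_inP cT.
have inj : injective (fun i => enum_val (widen_ord leT i)).
  by move=> i j /enum_val_inj /(congr1 val) /= /val_inj.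
split=> // i j; have [-> | ij] := eqVneq i j; first by rewrite !adj_irrefl.
rewrite [RHS]ij; have /forall_inP/(_ _ (enum_valP (widen_ord leT j))) :=
  cT _ (enum_valP (widen_ord leT i)).
by rewrite (inj_eq inj) ij.
Qed.

(** * Cliques and the clique number *)

Lemma card_clique_omega (G : sgraph) (S : {set G}) : clique S -> #|S| <= omega G.
Proof. exact: (@leq_bigmax_cond _ (@clique G) (fun S => #|S|)). Qed.

Lemma cliqueU1 (G : sgraph) (x : G) (S : {set G}) :
  clique S -> {in S, forall y, x -- y} -> clique (x |: S).
Proof.
move=> /forall_inP cS xS; apply/forall_inP=> a /setU1P[-> | aS];
  apply/forall_inP=> b /setU1P[-> | bS].
- by rewrite eqxx.
- by rewrite xS ?implybT.
- by rewrite adj_sym xS ?implybT.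
by have /forall_inP/(_ _ bS) := cS a aS.
Qed.

Lemma clique_imset (G : sgraph) (I : finType) (w : I -> G) (B : {set I}) :
  (forall i j, i != j -> w i -- w j) -> clique (w @: B).
Proof.
move=> wadj; apply/forall_inP=> _ /imsetP[i _ ->].
apply/forall_inP=> _ /imsetP[j _ ->]; apply/implyP=> nij.
by apply: wadj; apply: contraNneq nij => ->.
Qed.

Lemma pairwise_adj_inj (G : sgraph) (I : finType) (w : I -> G) :
  (forall i j, i != j -> w i -- w j) -> injective w.
Proof.
move=> wadj i j e; apply/eqP; apply: contraT => /wadj.
by rewrite e adj_irrefl.
Qed.

(** The vertex [x] plays [K_1], the edge [a b] plays [K_2], and [p] vertices of [T] would play
    [K_p]. *)
Lemma join_free_clique (p : nat) (G : sgraph) (x a b : G) (T : {set G}) :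
  free (graph_join (graph_union (complete_graph 1) (complete_graph 2))
                   (complete_graph p)) G ->
  a -- b -> x != a -> x != b -> ~~ (x -- a) -> ~~ (x -- b) ->
  clique T -> {in T, forall y, [/\ x -- y, a -- y & b -- y]} -> #|T| < p.
Proof.
move=> freeJ ab xa xb nxa nxb cT adjT; rewrite ltnNge; apply/negP=> leT.
apply: (free_embedding freeJ).
apply: (embedding_join (embedding_union (embedding_complete1 x)
  (embedding_complete2 ab) _ _) (embedding_clique leT cT)).
- by move=> _ i; case: ifP.
- by move=> _ i; case: ifP.
move=> z i; have [] := adjT _ (enum_valP (widen_ord leT i)).
by case: z => // j; case: ifP.
Qed.

(** * Greedy extension of a colouring, and intermediate subsets *)

(** Vertices outside [W] are coloured one at a time. The bound counts colours, not vertices, inside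
    [W], and all neighbours outside [W], coloured or not, so any order works. *)
Lemma greedy_colorable (G : sgraph) (k : nat) (W : {set G}) (c0 : G -> 'I_k) :
  {in W &, forall x y, x -- y -> c0 x != c0 y} ->
  (forall x, x \notin W ->
     #|[set c0 y | y in W & x -- y]| + #|[set y in ~: W | x -- y]| < k) ->
  colorable G k.
Proof.
move=> c0P lt_k.
(* Agreement with [c0] on [W] is carried through the induction, so that the colours excluded by [W]
   stay those of [c0]. *)
suff [c _ cP] : exists2 c : G -> 'I_k, {in W, c =1 c0} &
    {in W :|: [set x in enum (~: W)] &, forall x y, x -- y -> c x != c y}.
  have inAll x : x \in W :|: [set x in enum (~: W)].
    by rewrite !inE mem_enum !inE orbN.
  apply/existsP; exists [ffun x => c x]; apply/forallP=> x; apply/forallP=> y.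
  by apply/implyP=> xy; rewrite !ffunE; apply: cP.
have: {subset enum (~: W) <= ~: W} by move=> x; rewrite mem_enum.
elim: (enum (~: W)) => [_|x s IHs sub].
  by exists c0 => // x y; rewrite !inE !orbF; apply: c0P.
have [c cW cP] : exists2 c : G -> 'I_k, {in W, c =1 c0} &
    {in W :|: [set x in s] &, forall x y, x -- y -> c x != c y}.
  by apply: IHs => y ys; apply: sub; rewrite inE ys orbT.
have xW : x \notin W by have := sub x (mem_head _ _); rewrite inE.
(* The colours forbidden at the new vertex [x]. *)
pose F := [set c y | y in W :|: [set y in s] & x -- y].
have subF : F \subset [set c0 y | y in W & x -- y] :|:
                      c @: [set y in ~: W | x -- y].
  apply/subsetP=> _ /imsetP[y + ->]; rewrite inE => /andP[yWs xy]; rewrite inE.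
  have [yW | yW] := boolP (y \in W).
    by rewrite cW //; apply/orP; left; apply: imset_f; rewrite inE yW.
  by apply/orP; right; apply: imset_f; rewrite !inE yW.
have ltF : #|F| < k.
  apply: leq_ltn_trans (lt_k x xW); apply: leq_trans (subset_leq_card subF) _.
  apply: leq_trans (leq_card_setU _ _) _.
  by rewrite leq_add2l leq_imset_card.
have /card_gt0P[d] : 0 < #|~: F| by rewrite cardsCs setCK card_ord subn_gt0.
rewrite inE => dF.
have fresh y : y \in W :|: [set y in s] -> x -- y -> d != c y.
  by move=> yWs xy; apply: contraNneq dF => ->; apply: imset_f; rewrite inE yWs.
exists (fun y => if y == x then d else c y).
  by move=> y yW /=; case: eqP => [yx|_]; [rewrite -yx yW in xW | apply: cW].
have mem y : y != x -> y \in W :|: [set y in x :: s] ->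
    y \in W :|: [set y in s].
  by rewrite !inE => /negPf->.
move=> y z yM zM yz /=; case: (eqVneq y x) (eqVneq z x) => [yx|yx] [zx|zx].
- by rewrite yx zx adj_irrefl in yz.
- by apply: fresh (mem _ zx zM) _; rewrite -yx.
- by rewrite eq_sym; apply: fresh (mem _ yx yM) _; rewrite adj_sym -zx.
- by apply: cP => //; apply: mem.
Qed.

Lemma subset_between_card (T : finType) (D N : {set T}) (n : nat) :
  D \subset N -> #|D| <= n <= #|N| ->
  exists B : {set T}, [/\ D \subset B, B \subset N & #|B| = n].
Proof.
move=> DN /andP[Dn nN].
have /card_geqP[s [us ss sN]] : n - #|D| <= #|N :\: D|.
  by rewrite cardsDS //; apply: leq_sub2r.
exists (D :|: [set x in s]); split; first exact: subsetUl.
  rewrite subUset DN; apply/subsetP=> x; rewrite inE => /sN.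
  by rewrite inE => /andP[].
rewrite cardsU (_ : D :&: _ = set0) ?cards0.
  by rewrite cardsE (card_uniqP us) ss subn0 subnKC.
apply/setP=> x; rewrite !inE; apply/negP=> /andP[xD /sN].
by rewrite inE xD.
Qed.

(** * The parts determined by a maximum clique *)

(** The partition is studied from this pairwise adjacency alone: [omega G] pairwise adjacent
    vertices are distinct and form a maximum clique. *)
Lemma maximum_clique_adj (G : sgraph) (A : {set G}) (v : 'I_(omega G) -> G) :
  maximum_clique A -> injective v -> A = [set v k | k : 'I_(omega G)] ->
  forall i j, i != j -> v i -- v j.
Proof.
move=> [/forall_inP cA _] vinj EA i j ij.
have vA k : v k \in A by rewrite EA imset_f.
by have /forall_inP/(_ _ (vA j)) := cA _ (vA i); rewrite (inj_eq vinj) ij.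
Qed.

Section Partition.

Variables (G : sgraph) (v : 'I_(omega G) -> G).
Hypothesis vadj : forall i j, i != j -> v i -- v j.

Let vinj : injective v := pairwise_adj_inj vadj.

Lemma Iset_adj (k i : 'I_(omega G)) (x : G) :
  x \in Iset v k -> i != k -> x -- v i.
Proof. by rewrite !inE => /andP[_ /forallP/(_ i)/implyP]. Qed.

Lemma Iset_notin (k : 'I_(omega G)) (x : G) (i : 'I_(omega G)) :
  x \in Iset v k -> x != v i.
Proof.
by rewrite !inE => /andP[xA _]; apply: contraNneq xA => ->; rewrite imset_f.
Qed.

(** Otherwise [x] would extend the whole clique of the [v i]. *)
Lemma Iset_nadj (k : 'I_(omega G)) (x : G) : x \in Iset v k -> ~~ (x -- v k).
Proof.
move=> xI; apply/negP=> xk.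
have: clique (x |: v @: [set: 'I_(omega G)]).
  apply: cliqueU1 (clique_imset _ vadj) _ => _ /imsetP[i _ ->].
  by have [-> // | ik] := eqVneq i k; apply: Iset_adj ik.
move/card_clique_omega; rewrite cardsU1 card_imset // cardsT card_ord.
case: imsetP => [[i _ xv]|_]; last by rewrite ltnn.
by have := Iset_notin i xI; rewrite xv eqxx.
Qed.

(** Two adjacent vertices of [Iset v k] could replace [v k] in the clique, giving one of size
    [omega G + 1]. *)
Lemma Iset_independent (k : 'I_(omega G)) (x y : G) :
  x \in Iset v k -> y \in Iset v k -> ~~ (x -- y).
Proof.
move=> xI yI; apply/negP=> xy.
have cB : clique (y |: v @: [set~ k]).
  apply: cliqueU1 (clique_imset _ vadj) _ => _ /imsetP[i ik ->].
  by apply: Iset_adj yI _; rewrite !inE in ik.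
have: clique (x |: (y |: v @: [set~ k])).
  apply: cliqueU1 cB _ => _ /setU1P[-> // | /imsetP[i ik ->]].
  by apply: Iset_adj xI _; rewrite !inE in ik.
have notv z : z \in Iset v k -> z \notin v @: [set~ k].
  by move=> zI; apply/imsetP=> -[i _]; apply/eqP/(Iset_notin i zI).
move/card_clique_omega; rewrite !cardsU1 !inE negb_or (edge_neq xy) !notv //=.
rewrite card_imset // cardsC1 card_ord; lia.
Qed.

Lemma Uset_v (k : 'I_(omega G)) : v k \in Uset v k.
Proof. exact: setU11. Qed.

Lemma Uset_independent (k : 'I_(omega G)) (x y : G) :
  x \in Uset v k -> y \in Uset v k -> ~~ (x -- y).
Proof.
case/setU1P=> [-> | xI] /setU1P[-> | yI]; rewrite ?adj_irrefl //.
- by rewrite adj_sym Iset_nadj.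
- exact: Iset_nadj.
exact: Iset_independent xI yI.
Qed.

(** By maximality [x] misses some [v i]; if it missed no other, it would lie in [Iset v i]. *)
Lemma notin_V1P (x : G) : x \notin V1 v ->
  exists i j, [/\ i != j, ~~ (x -- v i) & ~~ (x -- v j)].
Proof.
move=> xV; have xU k : x \notin Uset v k.
  by apply: contraNN xV => xU; apply/bigcupP; exists k.
have xv k : x != v k by apply: contraNneq (xU k) => ->; apply: Uset_v.
have xA : x \notin [set v i | i : 'I_(omega G)].
  by apply/imsetP=> -[i _]; apply/eqP/xv.
have [/existsP[i nxi] | all] := boolP [exists i, ~~ (x -- v i)].
  have := xU i; rewrite !inE negb_or xA /= => /andP[_ /forallPn[j]].
  rewrite negb_imply => /andP[ji nxj].
  by exists i, j; rewrite eq_sym.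
have: clique (x |: v @: [set: 'I_(omega G)]).
  apply: cliqueU1 (clique_imset _ vadj) _ => _ /imsetP[i _ ->].
  by apply: contraNT all => nxi; apply/existsP; exists i.
move/card_clique_omega; rewrite cardsU1 card_imset // cardsT card_ord.
case: imsetP => [[i _ e]|_]; last by rewrite ltnn.
by have := xv i; rewrite e eqxx.
Qed.

(** Lets results about vertices outside [V1] apply to [V2]: a vertex of [Iset v k] can miss only
    [v k], whereas [x] misses two distinct clique vertices. *)
Lemma V2_notin_V1 (x : G) : x \in V2 v -> x \notin V1 v.
Proof.
case/bigcupP=> -[i j] /= lij; rewrite !inE => /andP[_ /and3P[xA nxi nxj]].
apply/bigcupP=> -[k _]; rewrite !inE xA /= => /predU1P[xv | /forallP xI].
  by case/negP: xA; rewrite xv imset_f.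
have [ik | ik] := eqVneq i k; last by have := xI i; rewrite ik (negPf nxi).
have := xI j; rewrite (negPf nxj) implybF negbK -ik => /eqP ji.
by rewrite ji ltnn in lij.
Qed.

(** * Consequences of the two forbidden subgraphs *)

Variable p : nat.
Hypothesis p_gt0 : 0 < p.
Hypothesis freeU : free (graph_union (path_graph 3) (path_graph 2)) G.
Hypothesis freeJ :
  free (graph_join (graph_union (complete_graph 1) (complete_graph 2))
                   (complete_graph p)) G.
Hypothesis omega_ge : maxn 3 (3 * p - 1) <= omega G.

(** The real case is [x] in [Iset v k] and [y] in [Iset v l]. If they were not adjacent, [x] and the
    edge from [y] to [v k] would form [K_1 u K_2], joined to the other [omega G - 2 >= p] clique
    vertices. *)
Lemma Uset_adj (k l : 'I_(omega G)) (x y : G) :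
  k != l -> x \in Uset v k -> y \in Uset v l -> x -- y.
Proof.
move=> kl /setU1P[-> | xI] /setU1P[-> | yI].
- exact: vadj.
- by rewrite adj_sym; apply: Iset_adj kl.
- by apply: Iset_adj xI _; rewrite eq_sym.
apply: contraT => nxy; suff : #|v @: ~: [set k; l]| < p.
  rewrite card_imset // cardsCs setCK card_ord cards2 kl; lia.
apply: (@join_free_clique p G x y (v k)) => //.
- by apply: Iset_adj yI _.
- by apply: contraTneq (Iset_adj yI kl) => <-; apply: Iset_nadj.
- exact: Iset_notin xI.
- exact: Iset_nadj.
- exact: clique_imset.
move=> _ /imsetP[i + ->]; rewrite !inE negb_or => /andP[ik il].
split; [exact: Iset_adj xI ik | exact: Iset_adj yI il |].
by apply: vadj; rewrite eq_sym.
Qed.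

(** By [Uset_adj] the [w k] form a clique. Those adjacent to [x] differ from [w i] and [w j], hence
    are joined to [x] and to the edge [w i], [w j]. *)
Lemma transversal_degree (w : 'I_(omega G) -> G) (x : G) (i j : 'I_(omega G)) :
  (forall k, w k \in Uset v k) -> x \notin V1 v ->
  i != j -> ~~ (x -- w i) -> ~~ (x -- w j) ->
  #|[set k | x -- w k]| < p.
Proof.
move=> wU xV ij nxi nxj.
have wadj k l : k != l -> w k -- w l by move=> kl; apply: Uset_adj kl _ _.
have xw k : x != w k.
  by apply: contraNneq xV => ->; apply/bigcupP; exists k.
rewrite -(card_imset _ (pairwise_adj_inj wadj)).
apply: (@join_free_clique p G x (w i) (w j)) => //; first exact: wadj.
  exact: clique_imset.
move=> _ /imsetP[k + ->]; rewrite inE => xk; split=> //; apply: wadj.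
  by apply: contraNneq nxi => ->.
by apply: contraNneq nxj => ->.
Qed.

Lemma clique_degree (x : G) : x \notin V1 v -> #|[set k | x -- v k]| < p.
Proof.
move=> xV; have [i [j [ij nxi nxj]]] := notin_V1P xV.
exact: transversal_degree Uset_v xV ij nxi nxj.
Qed.

(** If [x] met at least [p] parts, a transversal could be chosen in which [x] has
    exactly [p] neighbours, hence at least two non-neighbours. *)
Lemma part_degree (x : G) : x \notin V1 v ->
  #|[set k | [exists y in Uset v k, x -- y]]| < p.
Proof.
move=> xV; set N := [set k | _]; rewrite ltnNge; apply/negP=> leN.
pose D := [set k | x -- v k].
have DN : D \subset N.
  apply/subsetP=> k; rewrite !inE => xk; apply/existsP; exists (v k).
  by rewrite Uset_v.
have [|B [DB BN cardB]] := @subset_between_card _ D N p DN.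
  by rewrite ltnW ?clique_degree.
(* Since [B] contains [D], the choice [v k] off [B] is a non-neighbour of [x]; since [B] lies in
   [N], the [pick] succeeds on [B]. *)
pose w k := if k \in B then odflt (v k) [pick y in Uset v k | x -- y] else v k.
have wU k : w k \in Uset v k.
  rewrite /w; case: ifP => _; last exact: Uset_v.
  by case: pickP => [y /andP[] // | _]; apply: Uset_v.
have wB : [set k | x -- w k] = B.
  apply/setP=> k; rewrite inE /w; have [kB | kB] := boolP (k \in B).
    case: pickP => [y /andP[] // | none] /=.
    by have := subsetP BN k kB; rewrite inE => /existsP[y]; rewrite none.
  by apply: contraNF kB => xk; apply: (subsetP DB); rewrite inE.
have /card_gt1P[i [j [iB jB ij]]] : 1 < #|~: B|.
  by rewrite cardsCs setCK card_ord cardB; lia.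
have nadj k : k \in ~: B -> ~~ (x -- w k).
  by rewrite inE -wB inE.
have := transversal_degree wU xV ij (nadj i iB) (nadj j jB).
by rewrite wB cardB ltnn.
Qed.

Lemma outside_V1_trans (x y z : G) :
  x \notin V1 v -> y \notin V1 v -> z \notin V1 v ->
  x -- y -> y -- z -> x != z -> x -- z.
Proof.
move=> xV yV zV xy yz xz; apply: contraT => nxz.
pose D t := [set k | t -- v k].
(* Each of the three vertices sees at most [p - 1] clique vertices, so together at most [3 * p - 3],
   while [omega G >= 3 * p - 1]. The edge on two missed ones is the [P_2]. *)
have /card_gt1P[i [j [iD jD ij]]] : 1 < #|~: (D x :|: D y :|: D z)|.
  rewrite cardsCs setCK card_ord.
  have := (clique_degree xV, clique_degree yV, clique_degree zV).
  have := (leq_of_leqif (leq_card_setU (D x :|: D y) (D z)),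
           leq_of_leqif (leq_card_setU (D x) (D y))).
  by rewrite -/(D x) -/(D y) -/(D z) => -[h1 h2] [[h3 h4] h5]; lia.
have neqV t k : t \notin V1 v -> t != v k.
  by apply: contraNneq => ->; apply/bigcupP; exists k => //; apply: Uset_v.
exfalso; apply: (free_embedding freeU).
apply: (embedding_union (embedding_path3 xy yz xz nxz)
                        (embedding_path2 (vadj ij))).
  by move=> [[|[|[|//]]] ?] l /=; case: ifP => _; apply: neqV.
move: iD jD; rewrite !inE !negb_or => /andP[/andP[xi yi] zi] /andP[/andP[xj yj] zj].
by move=> [[|[|[|//]]] ?] l /=; case: ifP.
Qed.

(** Two neighbours of [x] outside [V1] are adjacent by transitivity through [x], so together with
    [x] they all form a clique. *)
Lemma outside_V1_degree (x : G) : x \notin V1 v ->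
  #|[set y in ~: V1 v | x -- y]| < omega G.
Proof.
move=> xV; set N := [set y in _ | _].
have xN : x \notin N by rewrite !inE adj_irrefl andbF.
suff /card_clique_omega : clique (x |: N) by rewrite cardsU1 xN.
apply: cliqueU1 => [|y]; last by rewrite inE => /andP[].
apply/forall_inP=> a; rewrite !inE => /andP[aV xa].
apply/forall_inP=> b; rewrite !inE => /andP[bV xb]; apply/implyP=> ab.
by apply: (@outside_V1_trans a x b) => //; rewrite adj_sym.
Qed.

(** * The three conclusions *)

(** A vertex in two different parts would be adjacent to itself. *)
Lemma Uset_index_unique (k l : 'I_(omega G)) (x : G) :
  x \in Uset v k -> x \in Uset v l -> k = l.
Proof.
move=> xk xl; apply/eqP; apply: contraT => kl.
by have := Uset_adj kl xk xl; rewrite adj_irrefl.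
Qed.

Lemma V1_complete_multipartite :
  @complete_multipartite (induced (V1 v)) 'I_(omega G)
    (fun k => [set x | val x \in Uset v k]).
Proof.
have UV k x : x \in Uset v k -> x \in V1 v by move=> xU; apply/bigcupP; exists k.
have in_part k (x : induced (V1 v)) :
    (x \in [set x : induced (V1 v) | val x \in Uset v k]) = (val x \in Uset v k).
  by rewrite in_set.
split.
- move=> k; apply/set0Pn; exists (Sub (v k) (UV k _ (Uset_v k))).
  by rewrite in_part Uset_v.
- move=> i j ij; apply/pred0P=> x /=; rewrite !in_part; apply/negP=> /andP[xi xj].
  by rewrite (Uset_index_unique xi xj) eqxx in ij.
- apply/setP=> x; rewrite inE; have /bigcupP[k _ xk] := valP x.
  by apply/bigcupP; exists k => //; rewrite in_part.
move=> i j x y; rewrite !in_part => xi yj; have [ij | ij] /= := eqVneq i j.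
  by apply: negbTE; apply: Uset_independent xi _; rewrite ij.
exact: Uset_adj ij xi yj.
Qed.

Lemma V2_P3_free : free (path_graph 3) (induced (V2 v)).
Proof.
move=> S /isomorphic_embedding[f [finj fadj] _].
pose o n (h : n < 3) : path_graph 3 := Ordinal h.
pose a := @o 0 isT; pose b := @o 1 isT; pose c := @o 2 isT.
have fV t : val (f t) \notin V1 v by apply/V2_notin_V1/(valP (f t)).
(* The ends of the path are not adjacent, so [fadj] makes this adjacency contradictory. *)
suff : f a -- f c by rewrite fadj.
apply: (@outside_V1_trans _ (val (f b))) => //.
- by have := fadj a b; rewrite /= => ->.
- by have := fadj b c; rewrite /= => ->.
by rewrite (inj_eq val_inj) (inj_eq finj).
Qed.

Lemma colorable_omega : colorable G (omega G + p - 1).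
Proof.
have le_omega : omega G <= omega G + p - 1 by lia.
(* The default index is only reached outside [V1], where the greedy step assigns the colour
   instead. *)
have i0 : 'I_(omega G) by apply: (@Ordinal _ 0); lia.
pose part x := odflt i0 [pick k | x \in Uset v k].
have partP k x : x \in Uset v k -> part x = k.
  rewrite /part => xk; case: pickP => [l xl | /(_ k)]; last by rewrite xk.
  exact: Uset_index_unique xl xk.
pose c0 x := widen_ord le_omega (part x).
apply: (@greedy_colorable G _ (V1 v) c0) => [x y|x xV].
  case/bigcupP=> k _ xk /bigcupP[l _ yl] xy.
  rewrite /c0 -val_eqE /= (partP _ _ xk) (partP _ _ yl).
  apply: contraTneq xy => /val_inj kl.
  by apply: Uset_independent xk _; rewrite kl.
(* The colours seen by [x] in [V1] are the indices of the parts it meets, which [part_degree]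
   bounds. *)
have sub : [set c0 y | y in V1 v & x -- y] \subset
    widen_ord le_omega @: [set k | [exists y in Uset v k, x -- y]].
  apply/subsetP=> _ /imsetP[y + ->]; rewrite inE => /andP[/bigcupP[k _ yk] xy].
  rewrite /c0 (partP _ _ yk); apply: imset_f; rewrite inE.
  by apply/existsP; exists y; rewrite yk.
(* At most [p - 1] colours from [V1] and [omega G - 1] neighbours outside it: one less than the
   number of colours. *)
have := leq_trans (subset_leq_card sub) (leq_imset_card _ _).
have := (part_degree xV, outside_V1_degree xV) => -[h1 h2] h3.
by lia.
Qed.

End Partition.

Lemma chi_le (G : sgraph) (k : nat) : colorable G k -> chi G <= k.
Proof. by rewrite /chi; case: ex_minnP => m _; apply. Qed.

Theorem theorem3p4 (p : nat) (G : sgraph) (A : {set G})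
    (v : 'I_(omega G) -> G) :
  0 < p ->
  free (graph_union (path_graph 3) (path_graph 2)) G ->
  free (graph_join (graph_union (complete_graph 1) (complete_graph 2))
                   (complete_graph p)) G ->
  maxn 3 (3 * p - 1) <= omega G ->
  maximum_clique A ->
  injective v ->
  A = [set v k | k : 'I_(omega G)] ->
  [/\ @complete_multipartite (induced (V1 v)) 'I_(omega G)
        (fun k => [set x | val x \in Uset v k]),
      free (path_graph 3) (induced (V2 v))
    & chi G <= omega G + p - 1].
Proof.
move=> p_gt0 freeU freeJ om maxA vinj EA.
have vadj := maximum_clique_adj maxA vinj EA.
split; [exact: V1_complete_multipartite om | exact: V2_P3_free om |].
exact: chi_le (colorable_omega vadj p_gt0 freeU freeJ om).
Qed.
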